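(* Suppose an estimator receives only the relation defect $Dz$ of the unknown field $z\in\mathcal H$. For every $z\in\mathcal H$ and every nonzero $h\in\ker D$, the fields $z$ and $z+h$ induce exactly the same observation: $D(z+h)=Dz$. Consequently, if an admissible class $\mathcal Z\subseteq\mathcal H$ contains both $z$ and $z+h$, then no estimator based only on the relation defect (i.e. no map $\widehat z$ from the codomain of $D$ to $\mathcal H$, evaluated at the relation defect of the true field) can be correct on both: it is impossible that $\widehat z(Dz)=z$ and $\widehat z(D(z+h))=z+h$. In particular, if $\ker D$ contains a nonzero transported global shift $h$ and $z$ is a true field with $Dz=0$, then the wrong field $z+h$ is also perfectly consistent, $D(z+h)=0$, and is indistinguishable from the truth $z$ on the basis of relation defects.
   Context: Let $G=(V,E)$ be a finite directed multigraph with $V=\{1,\dots,n\}$. Each node $i$ carries a finite-dimensional real Hilbert space $\mathcal H_i$, and $\mathcal H=\bigoplus_{i=1}^n\mathcal H_i$; elements $z=(z_1,\dots,z_n)\in\mathcal H$ are called fields. Each edge $e=(i,j)$ carries a weight $w_e>0$ and a linear map (transport) $T_e:\mathcal H_i\to\mathcal H_j$. The relation defect operator $D:\mathcal H\to\bigoplus_{e\in E}\mathcal H_{\mathrm{head}(e)}$ is defined by $(Dz)_e=\sqrt{w_e}\,(z_j-T_ez_i)$ for $e=(i,j)$. A field is perfectly consistent if its defect is zero. When the transports are path-consistent, i.e. $T_{e}=M_jM_i^{-1}$ for each edge $e=(i,j)$ with invertible linear maps $M_i:\mathcal U\to\mathcal H_i$ from a common latent space $\mathcal U$, a transported global shift is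 a field $h$ of the form $h_i=M_iu$ for all $i$, with a fixed $u\in\mathcal U$. *)

(* Defs.v *)
From HB Require Import structures.
From mathcomp Require Import all_boot all_order all_algebra.
From mathcomp Require Import sesquilinear reals.

Set Implicit Arguments.
Unset Strict Implicit.
Unset Printing Implicit Defensive.

Import Order.TTheory GRing.Theory Num.Theory.
Local Open Scope ring_scope.

(* Completeness is automatic in finite dimension, so a finite-dimensional real
   Hilbert space is a finite-dimensional space with a positive definite
   symmetric bilinear form. *)
HB.mixin Record Vector_isHilbert (R : realType) (V : Type) of Vector R V :=
  { inner_subdef : {dot V for (idfun : R -> R)} }.

#[short(type="hilbertType")]
HB.structure Definition Hilbert (R : realType) :=
  { V of Vector_isHilbert R V & Vector R V }.

Definition inner (R : realType) (V : hilbertType R) :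
  {dot V for (idfun : R -> R)} := inner_subdef.
Arguments inner {R V}.

Definition dsum (R : realType) (I : finType) (H : I -> hilbertType R) : Type :=
  {dffun forall i : I, H i}.

Section DirectSum.
Variables (R : realType) (I : finType) (H : I -> hilbertType R).
Implicit Types (x y z : dsum H) (a : R).

HB.instance Definition _ := Choice.on (dsum H).

Definition dsum_fun (f : forall i, H i) : dsum H := [ffun i => f i].

Lemma dsum_funE f i : dsum_fun f i = f i. Proof. exact: ffunE. Qed.

Lemma dsumP x y : (forall i, x i = y i) -> x = y.
Proof. by move=> eq_xy; apply/ffunP. Qed.

Let add x y := dsum_fun (fun i => x i + y i).
Let opp x := dsum_fun (fun i => - x i).
Let scale a x := dsum_fun (fun i => a *: x i).

Fact dsum_addA : associative add.
Proof. by move=> x y z; apply: dsumP => i; rewrite !dsum_funE addrA. Qed.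
Fact dsum_addC : commutative add.
Proof. by move=> x y; apply: dsumP => i; rewrite !dsum_funE addrC. Qed.
Fact dsum_add0 : left_id (dsum_fun (fun=> 0)) add.
Proof. by move=> x; apply: dsumP => i; rewrite !dsum_funE add0r. Qed.
Fact dsum_addN : left_inverse (dsum_fun (fun=> 0)) opp add.
Proof. by move=> x; apply: dsumP => i; rewrite !dsum_funE addNr. Qed.

HB.instance Definition _ := GRing.isZmodule.Build (dsum H)
  dsum_addA dsum_addC dsum_add0 dsum_addN.

Fact dsum_scaleA a b x : scale a (scale b x) = scale (a * b) x.
Proof. by apply: dsumP => i; rewrite !dsum_funE scalerA. Qed.
Fact dsum_scale1 : left_id 1 scale.
Proof. by move=> x; apply: dsumP => i; rewrite !dsum_funE scale1r. Qed.
Fact dsum_scaleDr : right_distributive scale +%R.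
Proof. by move=> a x y; apply: dsumP => i; rewrite !dsum_funE scalerDr. Qed.
Fact dsum_scaleDl x : {morph scale^~ x : a b / a + b}.
Proof. by move=> a b; apply: dsumP => i; rewrite !dsum_funE scalerDl. Qed.

HB.instance Definition _ := GRing.Zmodule_isLmodule.Build R (dsum H)
  dsum_scaleA dsum_scale1 dsum_scaleDr dsum_scaleDl.

Lemma dsum0E i : (0 : dsum H) i = 0. Proof. exact: dsum_funE. Qed.
Lemma dsumDE x y i : (x + y) i = x i + y i. Proof. exact: dsum_funE. Qed.
Lemma dsumZE a x i : (a *: x) i = a *: x i. Proof. exact: dsum_funE. Qed.

Import VectorInternalTheory.

Fact dsum_vect_iso :
  Vector.axiom #|{: {i : I & 'I_(dim (H i))}}| (dsum H).
Proof.
pose J := {i : I & 'I_(dim (H i))}.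
pose f x : 'rV[R]_#|{: J}| :=
  \row_k v2r (x (tag (enum_val k))) 0 (tagged (enum_val k)).
pose g (r : 'rV[R]_#|{: J}|) := dsum_fun (fun i =>
  r2v (\row_j r 0 (enum_rank (Tagged (fun i => 'I_(dim (H i))) j : J)))).
exists f.
  by move=> a x y; apply/rowP => k; rewrite !mxE dsumDE dsumZE linearP !mxE.
exists g => [x|r].
  apply: dsumP => i; rewrite dsum_funE -[RHS]v2rK; congr (r2v _).
  by apply/rowP => j; rewrite !mxE enum_rankK.
apply/rowP => k; rewrite mxE dsum_funE r2vK mxE.
by congr (r 0 _); rewrite -[RHS]enum_valK; congr enum_rank; case: (enum_val k).
Qed.

HB.instance Definition _ := Lmodule_hasFinDim.Build R (dsum H) dsum_vect_iso.

Definition dsum_inner x y : R := \sum_i inner (x i) (y i).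

Fact dsum_inner_bilinear :
  bilinear_for (GRing.Scale.Law.clone _ _ ( *%R ) _)
    (GRing.Scale.Law.clone _ _ ((idfun : R -> R) \; *%R) _) dsum_inner.
Proof.
split=> [y a x z|x a y z]; rewrite /dsum_inner /= mulr_sumr -big_split /=;
  apply: eq_bigr => i _; rewrite dsumDE dsumZE.
- by rewrite linearPl.
- by rewrite linearPr.
Qed.

HB.instance Definition _ := bilinear_isBilinear.Build R (dsum H) (dsum H) R
  _ _ dsum_inner dsum_inner_bilinear.

Fact dsum_inner_sym x y : dsum_inner x y = (-1) ^+ false * dsum_inner y x.
Proof.
rewrite expr0 mul1r; apply: eq_bigr => i _.
by rewrite (@hermitian_subproof _ _ _ _ inner) expr0 mul1r.
Qed.

HB.instance Definition _ :=
  isHermitianSesquilinear.Build R (dsum H) false idfun dsum_inner dsum_inner_sym.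

Fact dsum_inner_gt0 x : x != 0 -> 0 < dsum_inner x x.
Proof.
have inner_gt0 i : x i != 0 -> 0 < inner (x i) (x i).
  exact: neq0_dnorm_gt0.
have inner_ge0 i : 0 <= inner (x i) (x i).
  by have [->|/inner_gt0/ltW//] := eqVneq (x i) 0; rewrite linear0r.
move=> x_neq0; rewrite lt0r sumr_ge0 ?andbT //.
apply: contra x_neq0; rewrite psumr_eq0 // => /allP x0.
apply/eqP/dsumP => i; rewrite dsum0E; apply/eqP/contraT => /inner_gt0.
by have /= /eqP -> := x0 i (mem_index_enum i); rewrite ltxx.
Qed.

HB.instance Definition _ :=
  isDotProduct.Build R (dsum H) dsum_inner dsum_inner_gt0.

HB.instance Definition _ := Vector_isHilbert.Build R (dsum H) dsum_inner.

End DirectSum.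

(* Parallel edges and self-loops are allowed. *)
Record multigraph (n : nat) :=
  Multigraph { edge : finType; etail : edge -> 'I_n; ehead : edge -> 'I_n }.

Section Defect.
Variables (R : realType) (n : nat) (G : multigraph n).
Variable H : 'I_n -> hilbertType R.

Variable w : edge G -> R.
Variable T : forall e : edge G, 'Hom(H (etail e), H (ehead e)).

Definition defect_fun (z : dsum H) : dsum (fun e : edge G => H (ehead e)) :=
  dsum_fun (H := fun e : edge G => H (ehead e))
    (fun e => Num.sqrt (w e) *: (z (ehead e) - T e (z (etail e)))).

Fact defect_fun_linear : linear defect_fun.
Proof.
move=> a x y; apply: dsumP => e.
rewrite dsumDE dsumZE !dsum_funE linearP.
by rewrite opprD addrACA -scalerBr scalerDr !scalerA [a * _]mulrC.
Qed.

HB.instance Definition _ :=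
  GRing.isLinear.Build R _ _ _ defect_fun defect_fun_linear.

Definition defect : 'Hom(dsum H, dsum (fun e : edge G => H (ehead e))) :=
  linfun defect_fun.

Lemma defectE z e :
  defect z e = Num.sqrt (w e) *: (z (ehead e) - T e (z (etail e))).
Proof. by rewrite lfunE dsum_funE. Qed.

Definition perfectly_consistent (z : dsum H) := defect z = 0.

Variables (U : vectType R) (M : forall i, 'Hom(U, H i)).

(* [f^-1%VF] is a two-sided inverse since every [M i] is bijective. *)
Definition path_consistent_via :=
  (forall i, bijective (M i)) /\
  (forall e, T e = (M (ehead e) \o (M (etail e))^-1)%VF).

Definition transported_global_shift (h : dsum H) :=
  exists u : U, forall i, h i = M i u.

End Defect.

(* Main.v *)
Require Import Defs.
From mathcomp Require Import all_boot all_order all_algebra.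
From mathcomp Require Import reals.

Import Order.TTheory GRing.Theory Num.Theory.
Local Open Scope ring_scope.

(** [D] is linear, hence constant on cosets of its kernel ([D_shift]), while a nonzero [h] really
    moves the field ([shift_neq]). An estimator sees one input for two distinct fields. When [z] is
    consistent, its coset is the kernel itself, so a shift in the kernel keeps it consistent. *)

Theorem theorem2 (R : realType) (n : nat) (G : multigraph n)
    (H : 'I_n -> hilbertType R)
    (w : edge G -> R) (w_gt0 : forall e : edge G, 0 < w e)
    (T : forall e : edge G, 'Hom(H (etail e), H (ehead e))) :
  let D := defect w T in
  [/\ (* fields differing by an element of the kernel have the same defect *)
      forall z h : dsum H, h \in lker D -> h != 0 -> D (z + h) = D z,
      (* no estimator based only on the defect is correct on both fields *)
      forall (Z : dsum H -> Prop) (z h : dsum H),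
        h \in lker D -> h != 0 -> Z z -> Z (z + h) ->
        forall zhat : dsum (fun e : edge G => H (ehead e)) -> dsum H,
          ~ (zhat (D z) = z /\ zhat (D (z + h)) = z + h)
    & (* transported global shifts *)
      forall (U : vectType R) (M : forall i : 'I_n, 'Hom(U, H i)),
        path_consistent_via T M ->
        forall h : dsum H,
          h \in lker D -> h != 0 -> transported_global_shift M h ->
          forall z : dsum H, perfectly_consistent w T z ->
            [/\ z + h != z,
                perfectly_consistent w T (z + h)
              & D (z + h) = D z]].
Proof.
move=> D.
have D_shift z h : h \in lker D -> D (z + h) = D z.
  by rewrite memv_ker => /eqP Dh; rewrite linearD [X in _ + X]Dh addr0.
have shift_neq (z h : dsum H) : h != 0 -> z + h != z.
  by apply: contra_neq; rewrite -[RHS]addr0 => /addrI.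
split=> [z h Dh _|Z z h Dh h_neq0 _ _ zhat|U M _ h Dh h_neq0 _ z Dz].
- exact: D_shift.
(* Both estimates are now [zhat (D z)]; substituting the first equation into the second leaves
   [z = z + h]. *)
- rewrite D_shift // => -[-> z_eq].
  by have := shift_neq z h h_neq0; rewrite -z_eq eqxx.
- by split; [exact: shift_neq | rewrite /perfectly_consistent D_shift | exact: D_shift].
Qed.
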